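(* Let $\alpha\in[0,1)$, let $G$ be a connected graph of order at least $2$, and let $u$ and $v$ be vertices of $G$ such that $T_G(u)=T_{\min}(G)$ and $T_G(v)=T_{\max}(G)$. Let \[ m_1=\max\{T_G(w)-(1-\alpha)d_G(u,w): w\in V(G)\setminus\{u\}\},\qquad m_2=\min\{T_G(w)-(1-\alpha)d_G(v,w): w\in V(G)\setminus\{v\}\}, \] and $e(w)=\max\{d_G(w,z): z\in V(G)\}$ for $w\in V(G)$. Then \[ \frac{m_2+\alpha T_{\max}(G)+\sqrt{(m_2-\alpha T_{\max}(G))^2+4(1-\alpha)^2T_{\max}(G)}}{2}\ \le\ \mu_{\alpha}(G) \] and \[ \mu_{\alpha}(G)\ \le\ \frac{m_1+\alpha T_{\min}(G)+\sqrt{(m_1-\alpha T_{\min}(G))^2+4(1-\alpha)^2e(u)T_{\min}(G)}}{2}. \] Equality holds in the first inequality if and only if $G$ is a complete graph, and equality holds in the second inequality if and only if $G$ is a DVDR graph.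
   Context: All graphs are finite, simple and undirected; $d_G(u,v)$ is the distance between $u$ and $v$ in the connected graph $G$. The transmission of a vertex $u$ is $T_G(u)=\sum_{v\in V(G)}d_G(u,v)$; $T_{\min}(G)$ and $T_{\max}(G)$ are the minimum and maximum of $T_G(w)$ over all vertices $w$. A connected graph $G$ on $n$ vertices is a distinguished vertex deleted regular (DVDR) graph if there is a vertex $v$ of degree $n-1$ such that $G-v$ (the graph obtained by deleting $v$ and its incident edges) is regular; in particular complete graphs are DVDR. Let $T(G)$ be the diagonal matrix of transmissions and $D(G)=(d_G(u,v))_{u,v\in V(G)}$ the distance matrix. For $\alpha\in[0,1)$, $D_{\alpha}(G)=\alpha T(G)+(1-\alpha)D(G)$, and $\mu_{\alpha}(G)$ (the distance $\alpha$-spectral radius) is the largest eigenvalue of the symmetric matrix $D_{\alpha}(G)$. *)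

(* Defs.v *)
From HB Require Import structures.
From mathcomp Require Import all_boot all_order all_algebra.
From mathcomp Require Import boolp classical_sets functions cardinality reals.
From mathcomp Require complex.

Set Implicit Arguments.
Unset Strict Implicit.
Unset Printing Implicit Defensive.

Import Order.TTheory GRing.Theory Num.Theory.

Local Open Scope nat_scope.

Record sgraph (V : finType) := SGraph {
  adj :> rel V;
  adj_sym : symmetric adj;
  adj_irrefl : irreflexive adj }.

Section Graphs.

Variable V : finType.
Implicit Types (G : sgraph V) (u v w : V).

Definition connected_graph G := forall u v, connect G u v.

Definition complete_graph G := forall u v, u != v -> G u v.

Definition degree G v := #|[set w | G v w]|.

Definition regular_graph G := exists k, forall v, degree G v = k.

Definition walk G u v n := [exists p : n.-tuple V, path G u p && (last u p == v)].

(* A shortest walk has length < #|V|; the value is #|V| if v is unreachable. *)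
Definition dist G u v := find (walk G u v) (iota 0 #|V|).

Definition transmission G u := \sum_v dist G u v.

Definition Tmax G := \max_w transmission G w.

(* The neutral value Tmax G never affects the minimum. *)
Definition Tmin G := \big[minn/Tmax G]_w transmission G w.

Definition ecc G w := \max_z dist G w z.

End Graphs.

Section VertexDeletion.

Variables (V : finType) (G : sgraph V) (v : V).

Definition del_adj : rel {w : V | w != v} := fun x y => G (val x) (val y).

Lemma del_adj_sym : symmetric del_adj.
Proof. by move=> x y; rewrite /del_adj adj_sym. Qed.

Lemma del_adj_irrefl : irreflexive del_adj.
Proof. by move=> x; rewrite /del_adj adj_irrefl. Qed.

Definition del_vertex : sgraph {w : V | w != v} :=
  SGraph del_adj_sym del_adj_irrefl.

End VertexDeletion.

Definition DVDR (V : finType) (G : sgraph V) :=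
  connected_graph G /\
  exists v, degree G v = #|V|.-1 /\ regular_graph (del_vertex G v).

Section DistanceFacts.

Variables (V : finType) (G : sgraph V).

Lemma dist_le_path (u : V) (p : seq V) :
  path G u p -> dist G u (last u p) <= size p.
Proof.
move=> Gp; have [ltp|lep] := ltnP (size p) #|V|; last first.
  by apply: leq_trans lep; rewrite -[X in _ <= X](size_iota 0) find_size.
rewrite leqNgt; apply/negP => /(before_find 0).
rewrite nth_iota // add0n => /negbT/negP; apply.
by apply/fintype.existsP; exists (in_tuple p); rewrite Gp eqxx.
Qed.

Lemma dist_path (u v : V) : connect G u v ->
  exists p : seq V, [/\ path G u p, last u p = v & size p = dist G u v].
Proof.
case/connectP => p0 /shortenP[p Gp /card_uniqP Up _] ->.
have ltp : size p < #|V| by rewrite -[(size p).+1]/(size (u :: p)) -Up max_card.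
have lt_d : dist G u (last u p) < #|V|.
  exact: leq_ltn_trans (dist_le_path Gp) ltp.
have: has (walk G u (last u p)) (iota 0 #|V|).
  by rewrite has_find size_iota.
move=> /(nth_find 0); rewrite nth_iota // add0n => /fintype.existsP[q /andP[Gq /eqP lq]].
by exists q; split=> //; rewrite size_tuple.
Qed.

Lemma Tmin_le (w : V) : Tmin G <= transmission G w.
Proof.
rewrite /Tmin; have := mem_index_enum w; elim: (index_enum V) => //= x s IH.
by rewrite inE big_cons geq_min => /predU1P[<-|/IH->]; rewrite ?leqnn ?orbT.
Qed.

Lemma Tmin_attained : 0 < #|V| -> exists w, transmission G w = Tmin G.
Proof.
move=> V0; have [w0 w0E] : exists w, transmission G w = Tmax G.
  by rewrite /Tmax; have [w ->] := @bigop.eq_bigmax V (transmission G) V0; exists w.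
rewrite /Tmin; elim: (index_enum V) => [|x s [w IH]].
  by exists w0; rewrite big_nil.
rewrite big_cons; case: leqP => _; [by exists x | by exists w].
Qed.

End DistanceFacts.

Local Open Scope classical_set_scope.
Local Open Scope ring_scope.

Section Spectral.

Variable R : realType.

Variables (V : finType) (alpha : R) (G : sgraph V).
Implicit Types u v w : V.

Definition distance_mx : 'M[R]_#|V| :=
  \matrix_(i, j) (dist G (enum_val i) (enum_val j))%:R.

Definition transmission_mx : 'M[R]_#|V| :=
  diag_mx (\row_i (transmission G (enum_val i))%:R).

Definition distance_alpha_mx : 'M[R]_#|V| :=
  alpha *: transmission_mx + (1 - alpha) *: distance_mx.

(* The supremum of the spectrum is its largest element: see mu_alpha_max. *)
Definition mu_alpha : R :=
  sup [set a : R | eigenvalue distance_alpha_mx a].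

(* sup and inf of finite sets, nonempty as soon as 1 < #|V|: see m1_max and
   m2_min. *)
Definition m1 u : R :=
  sup [set (transmission G w)%:R - (1 - alpha) * (dist G u w)%:R
      | w in [set w | w != u]].

Definition m2 v : R :=
  inf [set (transmission G w)%:R - (1 - alpha) * (dist G v w)%:R
      | w in [set w | w != v]].

End Spectral.

Section LargestEigenvalue.

Variable R : realType.

Lemma finite_has_max (A : set R) : finite_set A -> A !=set0 ->
  exists2 x, A x & ubound A x.
Proof.
case/finite_seqP => s ->; elim: s => [[]//|x s IH _] /=.
case: s IH => [|y s] IH.
  by exists x => [|z] /=; rewrite inE // => /eqP->.
have [|z zs zub] := IH; first by exists y; rewrite /= inE eqxx.
have [xz|/ltW zx] := leP x z.
  exists z; first by rewrite /= inE zs orbT.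
  by move=> t /=; rewrite inE => /predU1P[->//|/zub].
exists x; first by rewrite /= inE eqxx.
by move=> t /=; rewrite inE => /predU1P[->//|/zub] /le_trans; apply.
Qed.

Lemma sup_max (A : set R) : finite_set A -> A !=set0 ->
  A (sup A) /\ ubound A (sup A).
Proof.
move=> Af A0; have [x Ax xub] := finite_has_max Af A0.
suff -> : sup A = x by [].
apply/eqP; rewrite eq_le; apply/andP; split; first exact: ge_sup.
by apply: ub_le_sup => //; exists x.
Qed.

Lemma inf_min (A : set R) : finite_set A -> A !=set0 ->
  A (inf A) /\ lbound A (inf A).
Proof.
move=> Af [a Aa]; have Nf : finite_set (-%R @` A) by exact: finite_image.
have N0 : (-%R @` A) !=set0 by exists (- a), a.
have [[x Ax xE] Aub] := sup_max Nf N0.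
rewrite /inf -xE opprK; split=> // y Ay.
by rewrite -lerN2 xE; apply: Aub; exists y.
Qed.

Lemma m1_max (V : finType) (alpha : R) (G : sgraph V) (u : V) : (1 < #|V|)%N ->
  (exists2 w, w != u &
     m1 alpha G u = (transmission G w)%:R - (1 - alpha) * (dist G u w)%:R) /\
  forall w, w != u ->
     (transmission G w)%:R - (1 - alpha) * (dist G u w)%:R <= m1 alpha G u.
Proof.
move=> /card_gt1P[x [y [_ _ xy]]]; rewrite /m1; set A := image _ _.
have Af : finite_set A by apply: finite_image; exact: finite_finset.
have [||[w wu <-] ub] := @sup_max A => //.
  have [xu|xu] := eqVneq x u; last by eexists; exists x.
  by eexists; exists y => //=; rewrite -xu eq_sym.
by split=> [|z zu]; [exists w | apply: ub; exists z].
Qed.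

Lemma m2_min (V : finType) (alpha : R) (G : sgraph V) (v : V) : (1 < #|V|)%N ->
  (exists2 w, w != v &
     m2 alpha G v = (transmission G w)%:R - (1 - alpha) * (dist G v w)%:R) /\
  forall w, w != v ->
     m2 alpha G v <= (transmission G w)%:R - (1 - alpha) * (dist G v w)%:R.
Proof.
move=> /card_gt1P[x [y [_ _ xy]]]; rewrite /m2; set A := image _ _.
have Af : finite_set A by apply: finite_image; exact: finite_finset.
have [||[w wu <-] lb] := @inf_min A => //.
  have [xv|xv] := eqVneq x v; last by eexists; exists x.
  by eexists; exists y => //=; rewrite -xv eq_sym.
by split=> [|z zv]; [exists w | apply: lb; exists z].
Qed.

Lemma dist_sym (V : finType) (G : sgraph V) (u v : V) : dist G u v = dist G v u.
Proof.
rewrite /dist; apply: eq_find => n.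
suff imp x y : walk G x y n -> walk G y x n by apply/idP/idP; apply: imp.
case/fintype.existsP => p /andP[Gp /eqP <-]; apply/existsP.
have sz : size (rev (belast x p)) == n by rewrite size_rev size_belast size_tuple.
exists (Tuple sz) => /=; rewrite rev_path.
rewrite (eq_path (e' := G)) => [|a b]; last by rewrite adj_sym.
rewrite Gp /=; case: (tval p) => [|a s] /=; first by [].
by rewrite rev_cons last_rcons.
Qed.

Import complex.

Lemma symmetric_eigenvalue (n : nat) (A : 'M[R]_n) : (0 < n)%N -> A^T = A ->
  exists a, eigenvalue A a.
Proof.
move=> n0 Asym; pose C : numClosedFieldType := R[i]%C.
pose f : {rmorphism R -> C} := real_complex R.
have [a /eigenvalueP[v vA v0]] := eigenvalue_closed (map_mx f A) n0.
have fc x : (f x)^* = f x by apply/CrealP; rewrite complex_real.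
pose w := (map_mx (@Num.conj C) v)^T.
have wA : map_mx f A *m w = a^* *: w.
  have /(congr1 (fun M => (map_mx (@Num.conj C) M)^T)) := vA.
  rewrite map_mxM trmx_mul map_mxZ linearZ /= -/w => <-; congr (_ *m _).
  by apply/matrixP => i j; rewrite !mxE /= fc -{1}Asym mxE.
have : a *: (v *m w) = a^* *: (v *m w).
  by rewrite scalemxAl -vA -mulmxA wA scalemxAr.
move=> /matrixP/(_ 0 0); rewrite [LHS]mxE [RHS]mxE => /mulIf aE.
have vw : (v *m w) 0 0 != 0.
  rewrite mxE; apply: contra v0 => /eqP s0; apply/eqP/rowP => j.
  have pos i : true -> 0 <= v 0 i * w i 0 by rewrite !mxE mul_conjC_ge0.
  have /eqP := psumr_eq0P pos s0 (i:=j) isT.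
  by rewrite !mxE mul_conjC_eq0 => /eqP.
have /esym/CrealP aR := aE vw.
exists (complex.Re a); rewrite -(eigenvalue_map f).
suff -> : f (complex.Re a) = a by apply/eigenvalueP; exists v.
exact: RRe_real.
Qed.

Lemma mu_alpha_max (V : finType) (alpha : R) (G : sgraph V) : (0 < #|V|)%N ->
  eigenvalue (distance_alpha_mx alpha G) (mu_alpha alpha G) /\
  forall a, eigenvalue (distance_alpha_mx alpha G) a -> a <= mu_alpha alpha G.
Proof.
move=> V0; set A := distance_alpha_mx alpha G.
have Asym : A^T = A.
  apply/matrixP => i j; rewrite !mxE dist_sym (eq_sym j i); congr (_ * _ + _).
  by case: eqVneq => [->|].
have fin : finite_set [set a | eigenvalue A a].
  suff [s sP] : exists s : seq R, forall a, eigenvalue A a -> a \in s.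
    by apply: (sub_finite_set (B := [set` s])) => //; exact: finite_seq.
  have pn0 : char_poly A != 0 by rewrite monic_neq0 // char_poly_monic.
  apply: contrapT => /forallNP noS.
  have big k : exists s : seq R, [/\ uniq s, size s = k &
      all (root (char_poly A)) s].
    elim: k => [|k [s [us sk rs]]]; first by exists [::].
    have := noS s => /existsNP[a /not_implyP[ea /negP as']].
    exists (a :: s) => /=; rewrite sk us as' rs.
    by rewrite -eigenvalue_root_char ea.
  have [s [us sk rs]] := big (size (char_poly A)).
  by have := max_poly_roots pn0 rs us; rewrite sk ltnn.
have [a ea] := symmetric_eigenvalue V0 Asym.
have [|mA ub] := sup_max fin; first by exists a.
by split=> // b; exact: ub.
Qed.

End LargestEigenvalue.

(* Main.v *)
(**
  Compare D_alpha with the vector x that takes the value a > 0 at a chosen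
  vertex r and 1 elsewhere.  At r the entry of D_alpha x depends on T(r) only;
  at w <> r it is T(w) - (1 - alpha) d(r, w) + (1 - alpha) d(r, w) a, which
  1 <= d(r, w) <= e(r) and the definitions of m2 and m1 compare with
  (1 - alpha) a + m2 and (1 - alpha) e(r) a + m1.  Choosing a so that (a, 1) is
  an eigenvector of the resulting 2 x 2 matrix gives D_alpha x >= lambda x, resp.
  D_alpha x <= lambda x, with lambda the bound of the theorem.  The Rayleigh
  quotient of x, resp. pairing x with |y| for an eigenvector y of the largest
  eigenvalue, bounds that eigenvalue by lambda, with equality iff
  D_alpha x = lambda x, i.e. iff r is adjacent to all other vertices and these
  have equal transmissions.
*)
Require Import Defs.
From mathcomp Require Import all_boot all_order all_algebra.
From mathcomp Require Import reals.
From mathcomp Require Import complex zify lra.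

Import Order.TTheory GRing.Theory Num.Theory.
Local Open Scope ring_scope.

Set Implicit Arguments.
Unset Strict Implicit.
Unset Printing Implicit Defensive.

(** * Eigenvalue bounds for real symmetric matrices from positive test vectors *)

Section PositiveTestVector.

Variables (R : realType) (n : nat) (A : 'M[R]_n) (mu : R).
Hypothesis A_sym : A^T = A.

(** Diagonalise [A] over [R[i]] by a unitary [P]. In the coordinates [c = P x] the two sides become
    sums of [d_i |c_i|^2] and [mu |c_i|^2], and each [d_i] is an eigenvalue of [A]. *)
Lemma rayleigh_le (x : 'cV[R]_n) :
  (forall a, eigenvalue A a -> a <= mu) ->
  (x^T *m (A *m x)) 0 0 <= mu * (x^T *m x) 0 0.
Proof.
move=> mu_ub; pose C : numClosedFieldType := R[i]%C.
pose f : {rmorphism R -> C} := real_complex R.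
have fc y : (f y)^* = f y by apply/CrealP; rewrite complex_real.
have fmono y z : (f y <= f z) = (y <= z) by exact: lecR.
pose B := map_mx f A.
have B_real : B \is a realmx.
  by apply/mxOverP => i j; rewrite mxE complex_real.
have B_sym : B \is symmetricmx.
  by apply/is_hermitianmxP; rewrite expr0 scale1r map_mx_id // /B map_trmx A_sym.
have B_herm : B \is hermsymmx by exact: realsym_hermsym.
have P_unit := spectral_unitarymx B.
have d_real := hermitian_spectral_diag_real B_herm.
have /hermitian_normalmx/orthomx_spectralP B_eq := B_herm.
move: P_unit d_real B_eq; set P := spectralmx B; set d := spectral_diag B.
move=> P_unit d_real B_eq.
have PB : P *m B = diag_mx d *m P.
  by rewrite B_eq !mulmxA mulmxV ?unitarymx_unit // mul1mx.
(* [d_i] is real because [B] is hermitian. Row [i] of the invertible [P] is a nonzero left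
   eigenvector for it, and [eigenvalue_map] brings the real eigenvalue back to [A]. *)
have d_le i : d 0 i <= f mu.
  have d_i : f (complex.Re (d 0 i)) = d 0 i.
    by apply: RRe_real; move/mxOverP: d_real.
  rewrite -d_i fmono; apply: mu_ub; rewrite -(eigenvalue_map f) d_i.
  apply/eigenvalueP; exists (row i P).
    by rewrite -row_mul PB; apply/rowP => j; rewrite mul_diag_mx !mxE.
  apply/eqP => Pi0.
  have /(congr1 (row i)) := mulmxV (unitarymx_unit P_unit).
  rewrite row_mul Pi0 mul0mx => /rowP/(_ i)/eqP.
  by rewrite !mxE eqxx eq_sym oner_eq0.
pose X := map_mx f x; pose c := P *m X.
have X_tr : (map_mx (@Num.conj C) X^T) = map_mx f x^T.
  by apply/matrixP => i j; rewrite !mxE fc.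
have c_tr : map_mx (@Num.conj C) c^T = map_mx f x^T *m invmx P.
  by rewrite trmx_mul map_mxM X_tr invmx_unitary.
have quad : f ((x^T *m (A *m x)) 0 0) = \sum_i d 0 i * (c i 0 * (c i 0)^*).
  transitivity ((map_mx (@Num.conj C) c^T *m (diag_mx d *m c)) 0 0).
    have -> : diag_mx d *m c = P *m (B *m X) by rewrite /c !mulmxA PB.
    rewrite c_tr -mulmxA [invmx P *m _]mulmxA mulVmx ?unitarymx_unit //.
    by rewrite mul1mx -!map_mxM [RHS]mxE.
  rewrite mxE; apply: eq_bigr => i _; rewrite mul_diag_mx !mxE.
  by rewrite mulrCA [X in _ * X]mulrC.
have norm : f ((x^T *m x) 0 0) = \sum_i c i 0 * (c i 0)^*.
  transitivity ((map_mx (@Num.conj C) c^T *m c) 0 0).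
    by rewrite c_tr /c mulmxA mulmxKV ?unitarymx_unit // -map_mxM [RHS]mxE.
  by rewrite mxE; apply: eq_bigr => i _; rewrite !mxE mulrC.
rewrite -fmono rmorphM /= quad norm mulr_sumr; apply: ler_sum => i _.
by apply: ler_wpM2r; rewrite ?mul_conjC_ge0.
Qed.

Variables (x : 'cV[R]_n) (lambda : R).
Hypothesis x_gt0 : forall i, 0 < x i 0.

Lemma sqnorm_ge0 (y : 'cV[R]_n) : 0 <= (y^T *m y) 0 0.
Proof. by rewrite mxE; apply: sumr_ge0 => i _; rewrite !mxE -expr2 sqr_ge0. Qed.

(** The weighted residuals [s i] are nonnegative and sum to [x^T A x - lambda x^T x], which is at
    most [(mu - lambda) x^T x] by [rayleigh_le]. If [lambda = mu] they all vanish, and dividing by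
    [x_i > 0] gives the eigenvector equation. *)
Lemma eigenvalue_ge_test :
  (0 < n)%N -> (forall a, eigenvalue A a -> a <= mu) ->
  (forall i, lambda * x i 0 <= (A *m x) i 0) ->
  lambda <= mu /\ (lambda = mu -> A *m x = lambda *: x).
Proof.
move=> n_gt0 mu_ub le_Ax; have ray := rayleigh_le x mu_ub.
pose s i := x i 0 * ((A *m x) i 0 - lambda * x i 0).
have s_ge0 i : true -> 0 <= s i by rewrite mulr_ge0 ?subr_ge0 // ltW.
have s_sum : \sum_i s i = (x^T *m (A *m x)) 0 0 - lambda * (x^T *m x) 0 0.
  rewrite [X in X - _]mxE [X in _ * X]mxE mulr_sumr -sumrB.
  by apply: eq_bigr => i _; rewrite /s mulrBr [x^T _ _]mxE [x i 0 * (lambda * _)]mulrCA.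
have xx_gt0 : 0 < (x^T *m x) 0 0.
  rewrite lt_def sqnorm_ge0 andbT mxE psumr_neq0; last first.
    by move=> i _; rewrite mxE -expr2 sqr_ge0.
  apply/hasP; exists (Ordinal n_gt0); first by rewrite mem_index_enum.
  by rewrite mxE mulr_gt0.
have le_lm : lambda <= mu.
  rewrite -(ler_pM2r xx_gt0); apply: le_trans ray.
  by rewrite -subr_ge0 -s_sum sumr_ge0.
split=> // lm; have s0 : \sum_i s i = 0.
  apply/eqP; rewrite eq_le sumr_ge0 // andbT s_sum subr_le0.
  by rewrite {1}lm.
apply/matrixP => i j; rewrite ord1 [RHS]mxE.
have /eqP := psumr_eq0P s_ge0 s0 (i := i) isT.
by rewrite mulf_eq0 gt_eqF //= subr_eq0 => /eqP.
Qed.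

(** For an eigenvector [y] of [mu], the vector [z = |y|] satisfies [A z >= mu z]. Pairing with [x]
    and using symmetry, the nonnegative sums of [s] and [t] add up to [(lambda - mu) p] with
    [p > 0]. In the equality case both sums vanish. *)
Lemma eigenvalue_le_test :
  (forall i j, 0 <= A i j) -> (forall i j, i != j -> 0 < A i j) ->
  eigenvalue A mu ->
  (forall i, (A *m x) i 0 <= lambda * x i 0) ->
  mu <= lambda /\ (mu = lambda -> A *m x = lambda *: x).
Proof.
move=> A_ge0 A_gt0 /eigenvalueP[y yA y_neq0] Ax_le.
pose z : 'cV[R]_n := \col_i `|y 0 i|.
have z_ge0 i : 0 <= z i 0 by rewrite mxE.
(* Triangle inequality in [y A = mu y], followed by [mu <= |mu|]. *)
have Az_ge i : mu * z i 0 <= (A *m z) i 0.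
  have -> : (A *m z) i 0 = \sum_j `|y 0 j * A j i|.
    rewrite mxE; apply: eq_bigr => j _; rewrite -{1}A_sym !mxE normrM mulrC.
    by rewrite (ger0_norm (A_ge0 j i)).
  apply: le_trans (ler_norm_sum _ _ _).
  have /rowP/(_ i) := yA; rewrite !mxE => ->.
  by rewrite normrM ler_wpM2r // ler_norm.
have [k yk] : exists k, y 0 k != 0 by apply/rV0Pn.
have zk : 0 < z k 0 by rewrite mxE normr_gt0.
pose p := \sum_i x i 0 * z i 0.
have p_gt0 : 0 < p.
  rewrite /p (bigD1 k) //= ltr_pwDl ?mulr_gt0 //.
  by apply: sumr_ge0 => i _; rewrite mulr_ge0 // ltW.
pose s i := x i 0 * ((A *m z) i 0 - mu * z i 0).
pose t i := z i 0 * (lambda * x i 0 - (A *m x) i 0).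
have s_ge0 i : true -> 0 <= s i by rewrite mulr_ge0 ?subr_ge0 // ltW.
have t_ge0 i : true -> 0 <= t i by rewrite mulr_ge0 ?subr_ge0.
have st : \sum_i s i + \sum_i t i = (lambda - mu) * p.
  have swap : \sum_i x i 0 * (A *m z) i 0 = \sum_i z i 0 * (A *m x) i 0.
    have /(congr1 (fun M : 'M_1 => M 0 0)) : x^T *m (A *m z) = (z^T *m (A *m x))^T.
      by rewrite !trmx_mul trmxK A_sym mulmxA.
    rewrite [in RHS]mxE mxE [RHS]mxE => E.
    transitivity (\sum_j x^T 0 j * (A *m z) j 0).
      by apply: eq_bigr => i _; rewrite [x^T _ _]mxE.
    by rewrite E; apply: eq_bigr => i _; rewrite [z^T _ _]mxE.
  rewrite /s /t; under eq_bigr do rewrite mulrBr.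
  under [X in _ + X]eq_bigr do rewrite mulrBr.
  rewrite !sumrB swap addrCA [X in _ + X]addrAC subrr sub0r /p mulrBl !mulr_sumr; congr (_ - _).
    by apply: eq_bigr => i _; rewrite mulrCA [z _ _ * _]mulrC.
  by apply: eq_bigr => i _; rewrite mulrCA.
have s_sum_ge0 : 0 <= \sum_i s i by exact: sumr_ge0.
have t_sum_ge0 : 0 <= \sum_i t i by exact: sumr_ge0.
split=> [|ml].
  by rewrite -subr_ge0 -(pmulr_lge0 _ p_gt0) -st addr_ge0.
have /eqP := st; rewrite -ml subrr mul0r paddr_eq0 // => /andP[/eqP s0 /eqP t0].
have Az i : (A *m z) i 0 = mu * z i 0.
  have /eqP := psumr_eq0P s_ge0 s0 (i := i) isT.
  by rewrite mulf_eq0 gt_eqF //= subr_eq0 => /eqP.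
(* If [z_i = 0] with [i != k], then [(A z)_i >= A_ik z_k > 0], contradicting [A z = mu z]. So [z]
   has full support, and vanishing of [t] constrains every row. *)
have z_neq0 i : z i 0 != 0.
  have [<-|ki] := eqVneq k i; first by rewrite gt_eqF.
  apply/eqP => zi0; have /eqP := Az i; rewrite zi0 mulr0 mxE gt_eqF //.
  rewrite (bigD1 k) //= ltr_pwDl ?mulr_gt0 ?A_gt0 1?eq_sym //.
  by apply: sumr_ge0 => j _; rewrite mulr_ge0.
apply/matrixP => i j; rewrite ord1 [RHS]mxE ml.
have /eqP := psumr_eq0P t_ge0 t0 (i := i) isT.
by rewrite mulf_eq0 (negPf (z_neq0 i)) /= subr_eq0 => /eqP.
Qed.

End PositiveTestVector.

(** The square root strictly exceeds [|m - t|] because [c > 0]. The strict inequality later makes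
    the entry [a] of the test vector positive. *)
Lemma quadratic_larger_root (R : realType) (m t c : R) : 0 < c ->
  let lambda := (m + t + Num.sqrt ((m - t) ^+ 2 + 4 * c)) / 2 in
  m < lambda /\ (lambda - m) * (lambda - t) = c.
Proof.
move=> c_gt0 lambda; rewrite /lambda; set d := _ + 4 * c.
have d_ge0 : 0 <= d by have := sqr_ge0 (m - t); rewrite /d; lra.
have s_ge0 := sqrtr_ge0 d; have s2 := sqr_sqrtr d_ge0.
split; last by move: s2; rewrite /d; set s := Num.sqrt _; nra.
have sq_ge0 := sqr_ge0 (m - t).
have : `|m - t| < Num.sqrt d by rewrite -sqrtr_sqr ltr_sqrt /d; lra.
by rewrite ltr_norml => /andP[_]; set s := Num.sqrt _; lra.
Qed.

(** * Distances, transmissions and universal vertices of a connected graph *)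

Section ConnectedGraph.

Local Open Scope nat_scope.

Variables (V : finType) (G : sgraph V).
Hypothesis G_connected : connected_graph G.
Implicit Types u v w z : V.

Lemma distxx u : dist G u u = 0.
Proof. by apply/eqP; rewrite -leqn0 (@dist_le_path _ G u [::]). Qed.

Lemma dist_gt0 u v : (0 < dist G u v) = (u != v).
Proof.
have [<-|uv] := eqVneq; first by rewrite distxx.
have [[|x p] [_ + <-]] // := dist_path (G_connected u v).
by move=> /= uv'; rewrite uv' eqxx in uv.
Qed.

Lemma dist_eq1 u v : (dist G u v == 1) = G u v.
Proof.
apply/eqP/idP => [d1|Guv].
  have [p [Gp lp]] := dist_path (G_connected u v); rewrite d1.
  by case: p Gp lp => [|x []] //= /andP[Gux _] <-.
apply/eqP; rewrite eqn_leq dist_gt0; apply/andP; split.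
  by apply: (@dist_le_path _ G u [:: v]); rewrite /= Guv.
by apply: contraTneq Guv => ->; rewrite adj_irrefl.
Qed.

Lemma adj_dist u v : u != v -> G u v = (dist G u v <= 1).
Proof. by move=> uv; rewrite leq_eqVlt ltnS leqn0 dist_eq1 eqn0Ngt dist_gt0 uv orbF. Qed.

Lemma exists_neighbor u : 1 < #|V| -> exists w, G u w.
Proof.
move=> /card_gt1P[x [y [_ _ xy]]].
have [w uw] : exists w, u != w.
  by have [ux|ux] := eqVneq u x; [exists y; rewrite ux | exists x].
have [[|z p] [/= Gp lp _]] := dist_path (G_connected u w).
  by rewrite lp eqxx in uw.
by exists z; case/andP: Gp.
Qed.

Lemma transmissionD1 u : transmission G u = \sum_(w | w != u) dist G u w.
Proof. by rewrite /transmission (bigD1 u) //= distxx. Qed.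

Lemma sum1_neq u : \sum_(w | w != u) 1 = #|V|.-1.
Proof. by rewrite sum1_card cardC1. Qed.

Lemma transmission_ge u : #|V|.-1 <= transmission G u.
Proof.
rewrite transmissionD1 -(sum1_neq u); apply: leq_sum => w.
by rewrite dist_gt0 eq_sym.
Qed.

(** The transmission sums [#|V| - 1] distances, each at least 1, so it reaches this minimum only if
    all of them equal 1. *)
Lemma transmission_leP u :
  reflect (forall w, w != u -> G u w) (transmission G u <= #|V|.-1).
Proof.
apply: (iffP idP) => [le_T w wu|uG]; last first.
  rewrite transmissionD1 -(sum1_neq u); apply: leq_sum => w wu.
  by rewrite -adj_dist ?uG // eq_sym.
rewrite adj_dist 1?eq_sym // leqNgt; apply/negP => d_gt1.
move: le_T; apply/negP; rewrite -ltnNge transmissionD1 -(sum1_neq u).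
rewrite (bigD1 w) // [X in _ < X](bigD1 w) //= -addSn leq_add //.
by apply: leq_sum => z /andP[zu _]; rewrite dist_gt0 eq_sym.
Qed.

Lemma degree_universalP u :
  reflect (forall w, w != u -> G u w) (degree G u == #|V|.-1).
Proof.
rewrite /degree -(cardC1 u); apply: (iffP eqP) => [dE w wu|uG].
  have sub : [set w | G u w] \subset predC1 u.
    by apply/subsetP => z; rewrite !inE; apply: contraTneq => ->; rewrite adj_irrefl.
  have /subset_cardP/(_ sub)/(_ w) := dE.
  by rewrite !inE wu => ->.
apply: eq_card => w; rewrite !inE; apply/idP/idP => [|/uG //].
by apply: contraTneq => ->; rewrite adj_irrefl.
Qed.

(** Paths through [u] bound all distances by 2, so each [z != w] contributes 2 to the sum of
    distance and adjacency indicator. Hence equal transmissions and equal degrees are the same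
    condition. *)
Lemma transmission_degree u w : (forall z, z != u -> G u z) ->
  transmission G w + degree G w = 2 * #|V|.-1.
Proof.
move=> uG; have le2 z : dist G w z <= 2.
  have [->|wz] := eqVneq w z; first by rewrite distxx.
  have [wu|wu] := eqVneq w u.
    by apply: leq_trans (_ : 1 <= _) => //; rewrite -adj_dist // wu uG // -wu eq_sym.
  have [zu|zu] := eqVneq z u.
    by apply: leq_trans (_ : 1 <= _) => //; rewrite -adj_dist // zu adj_sym uG.
  apply: (@dist_le_path _ G w [:: u; z]).
  by rewrite /= adj_sym !uG.
have -> : degree G w = \sum_(z | z != w) G w z.
  rewrite /degree -sum1_card big_mkcond [RHS]big_mkcond; apply: eq_bigr => z _.
  rewrite inE; case: eqVneq => [->|_]; first by rewrite adj_irrefl.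
  by case: (G w z).
rewrite transmissionD1 -big_split /= -(sum1_neq w) big_distrr /=.
apply: eq_bigr => z; rewrite eq_sym => wz; rewrite adj_dist //.
by move: (le2 z) wz; rewrite -dist_gt0; case: (dist G w z) => [|[|[]]].
Qed.

Lemma degree_del_universal u (x : {w | w != u}) :
  (forall z, z != u -> G u z) -> degree G (val x) = (degree (del_vertex G u) x).+1.
Proof.
move=> uG; rewrite /degree (cardsD1 u) inE adj_sym uG ?(valP x) // add1n; congr _.+1.
rewrite -(card_imset _ val_inj); apply: eq_card => z; rewrite !inE.
apply/andP/imsetP => [[zu Gxz]|[y + ->]].
  by exists (Sub z zu) => //; rewrite inE.
by rewrite inE => ?; split=> //; exact: (valP y).
Qed.

(** The vertex [v] supplied by [DVDR] may differ from [u], but [u] has minimum transmission and is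
    therefore universal as well. Regularity then translates into constant transmission through
    [transmission_degree]. *)
Lemma DVDR_universal_regular u : 1 < #|V| -> transmission G u = Tmin G ->
  DVDR G <-> (forall w, w != u -> G u w) /\
             exists k, forall w, w != u -> transmission G w = k.
Proof.
move=> V_gt1 hu; split=> [[_ [v [/eqP/degree_universalP vG [k reg]]]]|[uG [k T_k]]].
  have uG : forall w, w != u -> G u w.
    apply/transmission_leP; rewrite hu; apply: leq_trans (Tmin_le G v) _.
    exact/transmission_leP.
  split=> //; exists (2 * #|V|.-1 - k.+1) => w wu.
  rewrite -(transmission_degree w uG).
  suff -> : degree G w = k.+1 by rewrite addnK.
  have deg_k z : z != v -> degree G z = k.+1.
    by move=> zv; rewrite -(reg (Sub z zv)) -degree_del_universal.
  (* Regularity of [G - v] says nothing about [v] itself. If [w = v], then [u != v] has degree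
     [k.+1], and [u] and [v] share the degree [#|V|.-1]. *)
  have [wv|/deg_k //] := eqVneq w v.
  have <- : degree G u = k.+1 by rewrite deg_k // -wv eq_sym.
  have /degree_universalP/eqP -> := uG.
  by rewrite wv; apply/eqP/degree_universalP.
split=> //; exists u; split; first exact/eqP/degree_universalP.
(* The degree in [G] is [2 * #|V|.-1 - k], and deleting [u] removes one neighbour. The predecessor
   is exact because that degree is positive. *)
exists (2 * #|V|.-1 - k).-1 => x; apply: succn_inj.
rewrite -degree_del_universal //.
have := transmission_degree (val x) uG; rewrite T_k ?(valP x) //.
have : 0 < degree G (val x) by rewrite degree_del_universal.
by move: (degree G (val x)) => d; lia.
Qed.

(** If a vertex of maximum transmission is universal, every transmission is at most [#|V|.-1], so
    every vertex is universal. *)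
Lemma complete_transmissionP v : transmission G v = Tmax G ->
  complete_graph G <-> (forall w, w != v -> G v w) /\
                       exists k, forall w, w != v -> transmission G w = k.
Proof.
move=> hv; split=> [Gc|[vG _] w z wz].
  split=> [w wv|]; first by rewrite Gc // eq_sym.
  exists #|V|.-1 => w _; apply/eqP; rewrite eqn_leq transmission_ge andbT.
  by apply/transmission_leP => z zw; rewrite Gc // eq_sym.
suff /transmission_leP : transmission G w <= #|V|.-1 by apply; rewrite eq_sym.
have /transmission_leP := vG; apply: leq_trans; rewrite hv.
exact: leq_bigmax.
Qed.

Lemma ecc_ge u w : dist G u w <= ecc G u.
Proof. exact: leq_bigmax. Qed.

Lemma ecc_universal u : 1 < #|V| -> (forall w, w != u -> G u w) -> ecc G u = 1.
Proof.
move=> V_gt1 uG; have [w uw] := exists_neighbor u V_gt1.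
apply/eqP; rewrite eqn_leq; apply/andP; split; last first.
  by have := ecc_ge u w; move: uw; rewrite -dist_eq1 => /eqP ->.
apply/bigmax_leqP => z _; have [->|zu] := eqVneq z u; first by rewrite distxx.
by rewrite -adj_dist ?uG // eq_sym.
Qed.

End ConnectedGraph.

(** * The action of the distance alpha-matrix on two-valued vectors *)

Section DistanceAlphaMatrix.

Variables (R : realType) (alpha : R) (V : finType) (G : sgraph V).
Hypotheses (alpha_ge0 : 0 <= alpha) (alpha_lt1 : alpha < 1).
Hypothesis G_connected : connected_graph G.

Lemma distance_alpha_mx_sym :
  (distance_alpha_mx alpha G)^T = distance_alpha_mx alpha G.
Proof.
apply/matrixP => i j; rewrite !mxE dist_sym (eq_sym j i); congr (_ * _ + _).
by case: eqVneq => [->|].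
Qed.

Lemma distance_alpha_mx_ge0 i j : 0 <= distance_alpha_mx alpha G i j.
Proof.
by rewrite !mxE addr_ge0 // mulr_ge0 // ?mulrn_wge0 // subr_ge0 ltW.
Qed.

Lemma distance_alpha_mx_gt0 i j : i != j -> 0 < distance_alpha_mx alpha G i j.
Proof.
move=> ij; rewrite !mxE (negPf ij) mulr0n mulr0 add0r mulr_gt0 ?subr_gt0 //.
by rewrite ltr0n dist_gt0 // (inj_eq enum_val_inj).
Qed.

Definition test_vector (r : V) (a : R) : 'cV[R]_#|V| :=
  \col_i (if enum_val i == r then a else 1).

Lemma test_vector_gt0 r a : 0 < a -> forall i, 0 < test_vector r a i 0.
Proof. by move=> a_gt0 i; rewrite mxE; case: ifP. Qed.

(** The test vector is the all-ones vector plus [a - 1] times the indicator of [r], so row [w] of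
    the distance matrix yields [T(w) + d(r, w) (a - 1)]. *)
Lemma distance_alpha_test r a i :
  (distance_alpha_mx alpha G *m test_vector r a) i 0 =
  if enum_val i == r
  then (alpha * a + (1 - alpha)) * (transmission G r)%:R
  else (transmission G (enum_val i))%:R
       + (1 - alpha) * ((dist G r (enum_val i))%:R * (a - 1)).
Proof.
set w := enum_val i; pose X z : R := if z == r then a else 1.
have dist_sum : \sum_z (dist G w z)%:R * X z =
    (transmission G w)%:R + (dist G r w)%:R * (a - 1).
  rewrite (bigD1 r) //= /X eqxx /transmission (bigD1 (P := predT) r) //= natrD.
  rewrite natr_sum dist_sym; under eq_bigr => z zr do rewrite (negPf zr) mulr1.
  by move: (\sum_(_ | _) _) => s; rewrite mulrBr mulr1; lra.
have -> : (distance_alpha_mx alpha G *m test_vector r a) i 0 =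
    alpha * (transmission G w)%:R * X w
    + (1 - alpha) * \sum_z (dist G w z)%:R * X z.
  rewrite mxE (eq_bigr (fun j => alpha * ((transmission G w)%:R *+ (i == j))
      * X (enum_val j) + (1 - alpha) * ((dist G w (enum_val j))%:R
      * X (enum_val j)))); last first.
    by move=> j _; rewrite !mxE mulrDl -!mulrA.
  rewrite big_split /= -mulr_sumr; congr (_ + _ * _).
    rewrite (bigD1 i) //= eqxx mulr1n big1 ?addr0 // => j ji.
    by rewrite eq_sym (negPf ji) mulr0n mulr0 mul0r.
  by rewrite [RHS](reindex (@enum_val V predT)) //; exact/onW_bij/enum_val_bij.
rewrite dist_sum /X; case: eqVneq => [->|_]; last by rewrite mulr1; lra.
by rewrite distxx // mul0r addr0; lra.
Qed.

Lemma test_vector_eigenP r a lambda :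
  (alpha * a + (1 - alpha)) * (transmission G r)%:R = lambda * a ->
  distance_alpha_mx alpha G *m test_vector r a = lambda *: test_vector r a <->
  forall w, w != r -> (transmission G w)%:R
     + (1 - alpha) * ((dist G r w)%:R * (a - 1)) = lambda.
Proof.
move=> root_eq; split=> [/colP eig w wr|eig].
  have := eig (enum_rank w); rewrite distance_alpha_test !mxE enum_rankK.
  by rewrite (negPf wr) mulr1.
apply/colP => i; rewrite distance_alpha_test !mxE.
by case: eqVneq => [//|/eig ->]; rewrite mulr1.
Qed.

(** * The two bounds on [mu_alpha] and their equality cases *)

Hypothesis order_ge2 : (1 < #|V|)%N.

Lemma transmission_natr_gt0 w : 0 < (transmission G w)%:R :> R.
Proof.
by rewrite ltr0n; apply: leq_trans _ (transmission_ge G_connected w); lia.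
Qed.

(* [lambda] is the larger eigenvalue of the matrix
   [[alpha * T, (1 - alpha) * T], [(1 - alpha) * e, m]], and [(a, 1)] a
   positive eigenvector. *)
Lemma test_value_exists (r : V) (m e : R) : 0 < e ->
  let T := (transmission G r)%:R in
  let lambda := (m + alpha * T
     + Num.sqrt ((m - alpha * T) ^+ 2 + 4 * (1 - alpha) ^+ 2 * e * T)) / 2 in
  exists a, [/\ 0 < a, lambda = (1 - alpha) * e * a + m &
                (alpha * a + (1 - alpha)) * T = lambda * a].
Proof.
move=> e_gt0 T lambda; have T_gt0 : 0 < T by exact: transmission_natr_gt0.
have beta_gt0 : 0 < 1 - alpha by rewrite subr_gt0.
have be_gt0 : 0 < (1 - alpha) * e by rewrite mulr_gt0.
have c_gt0 : 0 < (1 - alpha) ^+ 2 * e * T.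
  by rewrite mulr_gt0 // mulr_gt0 ?exprn_gt0.
have := quadratic_larger_root m (alpha * T) c_gt0.
rewrite [4 * _]mulrA [4 * _]mulrA -/lambda => -[m_lt root_eq].
(* Solved from the second row of the matrix. Multiplied by [(1 - alpha) * e], the first row becomes
   the quadratic equation [root_eq]. *)
pose a := (lambda - m) / ((1 - alpha) * e).
have aE : (1 - alpha) * e * a = lambda - m by rewrite mulrC divfK ?gt_eqF.
exists a; split; first by rewrite divr_gt0 ?subr_gt0.
  by rewrite aE subrK.
by apply: (mulfI (lt0r_neq0 be_gt0)); move: aE root_eq; nra.
Qed.

Lemma mu_alpha_lower_bound v :
  let T := (transmission G v)%:R in
  let lower := (m2 alpha G v + alpha * T
     + Num.sqrt ((m2 alpha G v - alpha * T) ^+ 2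
                 + 4 * (1 - alpha) ^+ 2 * T)) / 2 in
  lower <= mu_alpha alpha G /\
  (lower = mu_alpha alpha G <->
     (forall w, w != v -> G v w) /\
     exists k, forall w, w != v -> transmission G w = k).
Proof.
move=> T lower; have beta_gt0 : 0 < 1 - alpha by rewrite subr_gt0.
have V_gt0 : (0 < #|V|)%N by exact: ltnW.
have [mu_eig mu_ub] := mu_alpha_max alpha G V_gt0.
have [[w0 w0v m2_eq] m2_le] := m2_min alpha G v order_ge2.
have := test_value_exists v (m2 alpha G v) ltr01.
rewrite /= !mulr1 -/T -/lower => -[a [a_gt0 lowerE row_v]].
have d_ge1 w : w != v -> 1 <= (dist G v w)%:R :> R.
  by move=> wv; rewrite ler1n dist_gt0 // eq_sym.
have ba_gt0 : 0 < (1 - alpha) * a by rewrite mulr_gt0.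
have x_gt0 := test_vector_gt0 v a_gt0.
have [|le_mu eq_mu] := eigenvalue_ge_test distance_alpha_mx_sym
    x_gt0 (lambda := lower) V_gt0 mu_ub.
  move=> i; rewrite distance_alpha_test // mxE; case: eqVneq => [_|wv].
    by rewrite row_v.
  (* Row [w] exceeds [lower] by [(T(w) - (1 - alpha) d - m2) + (1 - alpha) a (d - 1)] with
     [d = d(v, w)], and both terms are nonnegative. *)
  by rewrite mulr1 lowerE; have := m2_le _ wv; have := d_ge1 _ wv; nra.
split=> //; have eigP := test_vector_eigenP row_v.
split=> [/eq_mu/eigP eig|[vG [k T_k]]].
  (* Equality kills both terms of the excess, and [(1 - alpha) * a > 0] leaves [d = 1]. *)
  have vG w : w != v -> dist G v w = 1%N.
    move=> wv; apply/eqP; rewrite eqn_leq dist_gt0 // [v == w]eq_sym wv andbT.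
    rewrite -(ler_nat R) -(ler_pM2l ba_gt0).
    by have := eig w wv; have := m2_le w wv; rewrite lowerE; nra.
  split=> [w wv|]; first by rewrite -dist_eq1 // vG.
  exists (transmission G w0) => w wv; apply/eqP; rewrite -(eqr_nat R).
  apply/eqP; have := eig w wv; have := eig w0 w0v; rewrite !vG //; lra.
have d1 w : w != v -> dist G v w = 1%N.
  by move=> wv; apply/eqP; rewrite dist_eq1 ?vG.
have /eigP Dx : forall w, w != v -> (transmission G w)%:R
    + (1 - alpha) * ((dist G v w)%:R * (a - 1)) = lower.
  by move=> w wv; rewrite lowerE m2_eq !d1 // !T_k //; lra.
(* The test vector is now a positive eigenvector for [lower], so the opposite test bounds [mu_alpha]
   by [lower]. *)
apply/eqP; rewrite eq_le le_mu.
have [] // := eigenvalue_le_test distance_alpha_mx_sym x_gt0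
  (lambda := lower) distance_alpha_mx_ge0 distance_alpha_mx_gt0 mu_eig.
by move=> i; rewrite Dx mxE.
Qed.

Lemma mu_alpha_upper_bound u :
  let T := (transmission G u)%:R in
  let upper := (m1 alpha G u + alpha * T
     + Num.sqrt ((m1 alpha G u - alpha * T) ^+ 2
                 + 4 * (1 - alpha) ^+ 2 * (ecc G u)%:R * T)) / 2 in
  mu_alpha alpha G <= upper /\
  (mu_alpha alpha G = upper <->
     (forall w, w != u -> G u w) /\
     exists k, forall w, w != u -> transmission G w = k).
Proof.
move=> T upper; have beta_gt0 : 0 < 1 - alpha by rewrite subr_gt0.
have V_gt0 : (0 < #|V|)%N by exact: ltnW.
have [mu_eig mu_ub] := mu_alpha_max alpha G V_gt0.
have [[w0 w0u m1_eq] m1_ge] := m1_max alpha G u order_ge2.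
have e_gt0 : 0 < (ecc G u)%:R :> R.
  by rewrite ltr0n; apply: leq_trans (ecc_ge G u w0); rewrite dist_gt0 // eq_sym.
have := test_value_exists u (m1 alpha G u) e_gt0.
rewrite /= -/T -/upper => -[a [a_gt0 upperE row_u]].
have d_le w : (dist G u w)%:R <= (ecc G u)%:R :> R by rewrite ler_nat ecc_ge.
have ba_gt0 : 0 < (1 - alpha) * a by rewrite mulr_gt0.
have x_gt0 := test_vector_gt0 u a_gt0.
have row_w w : w != u -> (transmission G w)%:R
    + (1 - alpha) * ((dist G u w)%:R * (a - 1)) <= upper.
  (* The slack is [(m1 - T(w) + (1 - alpha) d) + (1 - alpha) a (e(u) - d)] with [d = d(u, w)]. *)
  by move=> wu; rewrite upperE; have := m1_ge _ wu; have := d_le w; nra.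
have [|mu_le eq_mu] := eigenvalue_le_test distance_alpha_mx_sym
    x_gt0 (lambda := upper) distance_alpha_mx_ge0 distance_alpha_mx_gt0 mu_eig.
  move=> i; rewrite distance_alpha_test // mxE; case: eqVneq => [_|wu].
    by rewrite row_u.
  by rewrite mulr1 row_w.
split=> //; have eigP := test_vector_eigenP row_u.
split=> [/eq_mu/eigP eig|[uG [k T_k]]].
  have d_ecc w : w != u -> dist G u w = ecc G u.
    move=> wu; apply/eqP; rewrite eqn_leq ecc_ge /=.
    rewrite -(ler_nat R) -(ler_pM2l ba_gt0).
    by have := eig w wu; have := m1_ge w wu; rewrite upperE; nra.
  (* Equality puts all other vertices at distance [e(u)] from [u]; a neighbour of [u] shows that
     this distance is 1. *)
  have ecc1 : ecc G u = 1%N.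
    have [z uz] := exists_neighbor G_connected u order_ge2.
    rewrite -(d_ecc z); first by apply/eqP; rewrite dist_eq1.
    by apply: contraTneq uz => ->; rewrite adj_irrefl.
  split=> [w wu|]; first by rewrite -dist_eq1 // d_ecc // ecc1.
  exists (transmission G w0) => w wu; apply/eqP; rewrite -(eqr_nat R).
  apply/eqP; have := eig w wu; have := eig w0 w0u; rewrite !d_ecc //; lra.
have d1 w : w != u -> dist G u w = 1%N.
  by move=> wu; apply/eqP; rewrite dist_eq1 ?uG.
have /eigP Dx : forall w, w != u -> (transmission G w)%:R
    + (1 - alpha) * ((dist G u w)%:R * (a - 1)) = upper.
  move=> w wu; rewrite upperE ecc_universal // m1_eq !d1 // !T_k //; lra.
apply/eqP; rewrite eq_le mu_le.
have [] // := eigenvalue_ge_test distance_alpha_mx_sym x_gt0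
  (lambda := upper) V_gt0 mu_ub.
by move=> i; rewrite Dx [leRHS]mxE.
Qed.

End DistanceAlphaMatrix.

Unset Implicit Arguments.

Theorem theorem3p4 (R : realType) (alpha : R) (V : finType) (G : sgraph V)
    (u v : V) (alpha_ge0 : 0 <= alpha) (alpha_lt1 : alpha < 1)
    (G_connected : connected_graph G) (order_ge2 : (2 <= #|V|)%N)
    (hu : transmission G u = Tmin G) (hv : transmission G v = Tmax G) :
  let tmin : R := (Tmin G)%:R in
  let tmax : R := (Tmax G)%:R in
  let lower : R :=
    (m2 alpha G v + alpha * tmax
     + Num.sqrt ((m2 alpha G v - alpha * tmax) ^+ 2
                 + 4 * (1 - alpha) ^+ 2 * tmax)) / 2 in
  let upper : R :=
    (m1 alpha G u + alpha * tmin
     + Num.sqrt ((m1 alpha G u - alpha * tmin) ^+ 2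
                 + 4 * (1 - alpha) ^+ 2 * (ecc G u)%:R * tmin)) / 2 in
  [/\ lower <= mu_alpha alpha G,
      mu_alpha alpha G <= upper,
      lower = mu_alpha alpha G <-> complete_graph G
    & mu_alpha alpha G = upper <-> DVDR G].
Proof.
move=> tmin tmax lower upper.
have [lower_le lower_eq] :=
  mu_alpha_lower_bound alpha_ge0 alpha_lt1 G_connected order_ge2 v.
have [upper_ge upper_eq] :=
  mu_alpha_upper_bound alpha_ge0 alpha_lt1 G_connected order_ge2 u.
rewrite hv in lower_le lower_eq; rewrite hu in upper_ge upper_eq.
split=> //; first by rewrite (complete_transmissionP G_connected hv).
by rewrite (DVDR_universal_regular G_connected order_ge2 hu).
Qed.
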